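(* There exists a constant $c > 0$ such that for every integer $n \ge 2$, $$M(n) \le c\, n^{n-\frac{1}{2}} \ln n ,$$ where $M(n)$ denotes the maximum number of edges $|E|$ over all $n$-uniform hypergraphs $H=(V,E)$ that form a clique and have chromatic number $\chi(H) = 3$.
   Context: A hypergraph $H=(V,E)$ consists of a vertex set $V$ and a set $E$ of subsets of $V$, called edges (no multiple edges). It is $n$-uniform if $|e| = n$ for every $e \in E$. The chromatic number $\chi(H)$ is the minimum number of colors needed to color all vertices of $V$ so that every edge $e \in E$ contains at least two vertices of different colors. A hypergraph forms a clique if its edges are pairwise intersecting (any two edges have a common vertex). It is known (Erdős–Lovász) that an $n$-uniform clique with $\chi(H)=3$ has at most $n^n$ edges, so the maximum defining $M(n)$ is finite. *)

(* Defs.v *)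
From HB Require Import structures.
From mathcomp Require Import all_boot all_order all_algebra.
From mathcomp Require Import all_classical all_reals all_analysis.

Set Implicit Arguments.
Unset Strict Implicit.
Unset Printing Implicit Defensive.

Local Open Scope classical_set_scope.
Local Open Scope card_scope.

(* Neither the vertex set nor the edge set is assumed finite. *)
Record hypergraph := Hypergraph {
  vertex : Type;
  edges : set (set vertex)
}.

Arguments edges : clear implicits.

Definition uniform (n : nat) (H : hypergraph) : Prop :=
  forall e, edges H e -> e #= `I_n.

Definition clique (H : hypergraph) : Prop :=
  forall e f, edges H e -> edges H f -> e `&` f !=set0.

Definition proper_coloring (H : hypergraph) (k : nat)
    (col : vertex H -> 'I_k) : Prop :=
  forall e, edges H e -> exists x y, [/\ e x, e y & col x <> col y].

Definition colorable (H : hypergraph) (k : nat) : Prop :=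
  exists col : vertex H -> 'I_k, proper_coloring col.

Definition chromatic_number (H : hypergraph) (k : nat) : Prop :=
  colorable H k /\ forall j, colorable H j -> (k <= j)%N.

Definition admissible (n : nat) (H : hypergraph) : Prop :=
  [/\ uniform n H, clique H & chromatic_number H 3].

(* [max_edges n m] says M(n) = m. The second clause also excludes admissible
   hypergraphs with infinitely many edges. *)
Definition max_edges (n m : nat) : Prop :=
  (exists H, admissible n H /\ edges H #= `I_m) /\
  (forall H, admissible n H -> edges H #<= `I_m).

(* Main.v *)
Require Import Defs.
From HB Require Import structures.
From mathcomp Require Import all_boot all_order all_algebra.
From mathcomp Require Import all_classical all_reals all_analysis.
From mathcomp Require Import finmap zify ring lra.

Set Implicit Arguments.
Unset Strict Implicit.
Unset Printing Implicit Defensive.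

Import Order.TTheory GRing.Theory Num.Theory.
Local Open Scope ring_scope.

(** Since the hypergraph is not 2-colorable, no set of fewer than [n] vertices
    meets all edges. Given a set [A] of fewer than [n] vertices, choose an edge
    [e] disjoint from [A] and branch over the vertices of [e]: this bounds the
    number of edges containing [A] by [n ^ (n - #|A|)], hence the number of all
    edges by [n ^ n]. To gain on this, keep track of a union [U] of earlier
    branching edges and only count the edges [f] containing [A] that meet [U]
    inside [A]; such an [f] meets [e] outside [U]. Giving each [f] the weight
    [1 / #|f & e|] on each of its branches shows that
      [2 |F(A, U)| <= \sum_(x in e - U) (|F(A + x, U)| + |F(A + x, U + e)|)],
    so on average every second branching edge may be added to [U]. If [e] also
    avoids all the vertices lying on two edges of [U], it meets the edges of [U]
    in distinct vertices. So, once [U] is made of [g] edges, each step has at most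
    [n - g] branches; and if [e] meets [U] in [g] or more vertices before that,
    then this step already gains as much, without changing [U]. With [g] about
    [log n / log 2] the total gain over [n ^ n] is of order [n]: the number of
    edges is at most [4096 n ^ (n - 1)]. *)

(** * Branching over the vertices of an edge *)

Section Branching.
Local Open Scope fset_scope.
Local Open Scope nat_scope.

Definition extensions (T : choiceType) (F : {fset {fset T}}) (A U : {fset T}) :=
  [fset f in F | (A `<=` f) && (f `&` U `<=` A)].

Lemma card_fset_sumb (T : choiceType) (S : {fset T}) (P : pred T) :
  #|` [fset x in S | P x]| = \sum_(x <- S) P x.
Proof.
rewrite card_fset_sum1 big_fset /= big_mkcond /=.
by apply: eq_bigr => x _; case: (P x).
Qed.

Lemma extensionsU1 (T : choiceType) (F : {fset {fset T}}) (A U : {fset T}) (x : T) :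
  \sum_(f <- extensions F A U) (x \in f) <= #|` extensions F (x |` A) U|.
Proof.
rewrite -card_fset_sumb; apply: fsubset_leq_card; apply/fsubsetP => f.
rewrite !inE /= => /andP[/and3P[-> Af fUA] xf] /=.
rewrite fsubUset fsub1set xf Af /=.
by apply: fsubset_trans fUA _; apply: fsubsetUr.
Qed.

(** If [x] is the only vertex of [f] on [e], then once [x] belongs to [A] the edge [e] may join [U]
    without excluding [f]. *)
Lemma extensionsU1_single (T : choiceType) (F : {fset {fset T}})
    (A U e : {fset T}) (x : T) :
  \sum_(f <- extensions F A U) (f `&` e == [fset x])
    <= #|` extensions F (x |` A) (U `|` e)|.
Proof.
rewrite -card_fset_sumb; apply: fsubset_leq_card; apply/fsubsetP => f.
rewrite !inE /= => /andP[/and3P[-> Af fUA] /eqP fe] /=.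
have xf : x \in f.
  by have := fset11 x; rewrite -fe inE => /andP[].
rewrite fsubUset fsub1set xf Af /= fsetIUr fe fsubUset fsubsetUl andbT.
by apply: fsubset_trans fUA _; apply: fsubsetUr.
Qed.

(** A vertex of [f] in [U] lies in [A], which [e] avoids; so branching over the part of [e] outside
    [U] loses no edge. *)
Lemma extensions_meet (T : choiceType) (F : {fset {fset T}}) (A U e f : {fset T}) :
  f \in extensions F A U -> [disjoint e & A] -> f `&` e `<=` e `\` U.
Proof.
rewrite !inE /= => /and3P[_ _ /fsubsetP fUA] /fdisjointP eA.
apply/fsubsetP => x; rewrite !inE => /andP[xf xe]; rewrite xe andbT.
by apply/negP => xU; have := eA _ xe; rewrite fUA // inE xf.
Qed.

Lemma card_fsetI_sum (T : choiceType) (f e D : {fset T}) :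
  f `&` e `<=` D -> D `<=` e -> #|` f `&` e| = \sum_(x <- D) (x \in f).
Proof.
move=> feD De; rewrite -card_fset_sumb; congr #|` _|.
apply/fsetP => x; rewrite !inE /=; apply/andP/andP => -[h1 h2]; split=> //.
  by apply: (fsubsetP feD); rewrite inE h1.
exact: (fsubsetP De).
Qed.

Lemma branch_plain (T : choiceType) (F : {fset {fset T}}) (A U e : {fset T}) :
  [disjoint e & A] -> (forall f, f \in F -> f `&` e != fset0) ->
  #|` extensions F A U| <= \sum_(x <- e `\` U) #|` extensions F (x |` A) U|.
Proof.
move=> eA Fe.
apply: leq_trans (leq_sum _ (fun x _ => extensionsU1 F A U x)).
rewrite exchange_big /= card_fset_sum1 !big_seq; apply: leq_sum => f fS.
rewrite -(card_fsetI_sum (extensions_meet fS eA) (fsubsetDl _ _)).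
by rewrite cardfs_gt0 Fe //; move: fS; rewrite !inE => /andP[].
Qed.

(* An edge meeting [e] in one vertex is counted once in each summand, any other
   edge at least twice in the first. *)
Lemma branch_half (T : choiceType) (F : {fset {fset T}}) (A U e : {fset T}) :
  [disjoint e & A] -> (forall f, f \in F -> f `&` e != fset0) ->
  2 * #|` extensions F A U| <= \sum_(x <- e `\` U)
    (#|` extensions F (x |` A) U| + #|` extensions F (x |` A) (U `|` e)|).
Proof.
move=> eA Fe.
apply: leq_trans (leq_sum _ (fun x _ =>
  leq_add (extensionsU1 F A U x) (extensionsU1_single F A U e x))).
under eq_bigr do rewrite -big_split /=.
rewrite exchange_big /= card_fset_sum1 big_distrr /= !big_seq.
apply: leq_sum => f fS; rewrite big_split /=.
have feD := extensions_meet fS eA.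
rewrite -(card_fsetI_sum feD (fsubsetDl _ _)).
have fe0 : 0 < #|` f `&` e|.
  by rewrite cardfs_gt0 Fe //; move: fS; rewrite !inE => /andP[].
have [h1|h1] := eqVneq #|` f `&` e| 1; last by lia.
have /cardfs1P[x fex] : #|` f `&` e| == 1 by rewrite h1.
rewrite h1 fex (big_fsetD1 x) /= ?eqxx; first by lia.
by apply: (fsubsetP feD); rewrite fex inE.
Qed.

End Branching.

(** * Counting the edges of a critical clique *)

Section Bounds.
Local Open Scope fset_scope.

(** The last clause is the form in which non-2-colorability is used. [E] is a predicate because
    finiteness of the edge set is a consequence; the bounds concern finite subfamilies [F]. *)
Definition critical_clique (T : choiceType) (n : nat) (E : {fset T} -> Prop) :=
  [/\ forall e, E e -> #|` e| = n,
      forall e f, E e -> E f -> e `&` f != fset0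
    & forall S : {fset T}, (#|` S| < n)%N -> exists2 e, E e & [disjoint e & S]].

(** The weight [w] is abstract to serve both kinds of branching: a single count, or a sum of two. *)
Lemma sum_extensions_le (K : realDomainType) (T : choiceType) (A e D : {fset T})
    (w : {fset T} -> K) (m : nat) (B : K) :
  [disjoint e & A] -> D `<=` e -> (#|` D| <= m)%N -> 0 <= B ->
  (forall x, #|` x |` A| = #|` A|.+1 -> w (x |` A) <= B) ->
  \sum_(x <- D) w (x |` A) <= m%:R * B.
Proof.
move=> eA De Dm B0 wB.
apply: (@le_trans _ _ (\sum_(x <- D) B)).
  rewrite !big_seq; apply: ler_sum => x xD; apply: wB.
  by rewrite cardfsU1 (fdisjointP eA) //; exact: (fsubsetP De).
rewrite big_const_seq count_predT iter_addr_0 -[X in X <= _]mulr_natl.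
by apply: ler_wpM2r => //; rewrite ler_nat.
Qed.

Lemma extensions_le_expn (T : choiceType) (n : nat) (E : {fset T} -> Prop)
    (F : {fset {fset T}}) (k : nat) (A U : {fset T}) :
  critical_clique n E -> (forall f, f \in F -> E f) -> (#|` A| + k = n)%N ->
  (#|` extensions F A U| <= n ^ k)%N.
Proof.
move=> [En EI Edisj] FE; elim: k A => [|k IH] A Ak.
  have : extensions F A U `<=` [fset A].
    apply/fsubsetP => f; rewrite !inE /= => /and3P[fF Af _].
    by rewrite eq_sym eqEfcard Af (En _ (FE _ fF)) -Ak addn0 /=.
  by move=> /fsubset_leq_card; rewrite cardfs1.
have [|e Ee eA] := Edisj A; first by lia.
have Fe f : f \in F -> f `&` e != fset0 by move=> /FE fE; exact: EI.
apply: leq_trans (branch_plain U eA Fe) _.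
rewrite expnS -(ler_nat int) natr_sum natrM.
apply: (@sum_extensions_le _ _ A e (e `\` U) (fun B => #|` extensions F B U|%:R)) => //.
- exact: fsubsetDl.
- by rewrite -(En _ Ee); apply/fsubset_leq_card/fsubsetDl.
- by move=> x Ax; rewrite ler_nat IH // Ax; lia.
Qed.

(* [D] stores the vertices shared by two of the [j] edges whose union is [U]:
   an edge avoiding [D] meets these [j] edges in distinct vertices. *)
Definition spread (T : choiceType) (E : {fset T} -> Prop) (U D : {fset T}) (j : nat) :=
  forall e, E e -> [disjoint e & D] -> (j <= #|` e `&` U|)%N.

(** Avoiding the part of [e] in [U], the edge [f] meets [e] outside [U], which adds a vertex to the
    [j] old ones. *)
Lemma spreadS (T : choiceType) (E : {fset T} -> Prop) (U D e : {fset T}) (j : nat) :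
  (forall f, E f -> f `&` e != fset0) -> spread E U D j ->
  spread E (U `|` e) (D `|` (e `&` U)) j.+1.
Proof.
move=> Ee UDj f Ef; rewrite fdisjointXU => /andP[fD feU].
have := UDj f Ef fD.
have : (0 < #|` f `&` e|)%N by rewrite cardfs_gt0 Ee.
have := cardfsUI (f `&` U) (f `&` e); rewrite -fsetIUr.
have -> : f `&` U `&` (f `&` e) = fset0.
  apply/eqP; rewrite -fsubset0; apply/fsubsetP => x; rewrite !inE.
  move=> /andP[/andP[xf xU] /andP[_ xe]].
  by have := fdisjointP feU _ xf; rewrite inE xe xU.
by rewrite cardfs0; lia.
Qed.

(* [6 / 5] is any [a] with [1 + a^-1 <= 2 * (1 - g / n)] and [2 * a <= expR 1]:
   the first makes the induction work, the second the final estimate. *)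
Lemma extensions_le_decay (K : realFieldType) (T : choiceType) (n g : nat)
    (E : {fset T} -> Prop) (F : {fset {fset T}}) (r j : nat) (A U D : {fset T}) :
  critical_clique n E -> (forall f, f \in F -> E f) ->
  (0 < n)%N -> (12 * g <= n)%N ->
  (g * g + r + #|` A| = n)%N -> (j <= g)%N -> (#|` D| <= g * j)%N ->
  spread E U D j ->
  #|` extensions F A U|%:R
    <= n%:R ^+ (g * g + r) * (1 - g%:R / n%:R) ^+ r * (6 / 5) ^+ (g - j) :> K.
Proof.
move=> crit FE n0 gn.
have [En EI Edisj] := crit.
have nK : 0 < n%:R :> K by rewrite ltr0n.
set q : K := 1 - _.
have qn : n%:R * q = (n - g)%:R.
  by rewrite /q natrB ?mulrBr ?mulr1; [rewrite mulrCA divff ?mulr1 ?gt_eqF|lia].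
have q_ge : 11 / 12 <= q.
  rewrite -(ler_pM2l nK) qn natrB; last by lia.
  have : (12 * g)%:R <= n%:R :> K by rewrite ler_nat.
  by rewrite natrM; lra.
elim: r j A U D => [|r IH] j A U D Ar jg Dj UDj.
  rewrite expr0 mulr1 addn0.
  apply: (@le_trans _ _ (n%:R ^+ (g * g))).
    by rewrite -natrX ler_nat (extensions_le_expn U crit FE) //; lia.
  by rewrite ler_peMr ?exprn_ge0 ?exprn_ege1 //; lra.
have gj : (g * j <= g * g)%N by rewrite leq_mul2l jg orbT.
(* The reserve [g * g] in the exponent pays for [D]: [A] and [D] together have fewer than [n]
   vertices. *)
have [|e Ee] := Edisj (A `|` D).
  by have := cardfsU A D; lia.
rewrite fdisjointXU => /andP[eA eD].
have Fe f : f \in F -> f `&` e != fset0 by move=> /FE fE; exact: EI.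
have cardD := cardfsID U e; rewrite (En _ Ee) in cardD.
set N : K := n%:R ^+ (g * g + r); set a : K := 6 / 5.
have N0 : 0 <= N by rewrite exprn_ge0.
have a0 : 0 <= a by rewrite /a; lra.
have q0 : 0 <= q by lra.
have B0 k : 0 <= N * q ^+ r * a ^+ k by rewrite !mulr_ge0 // exprn_ge0.
have -> : n%:R ^+ (g * g + r.+1) = n%:R * N :> K by rewrite addnS exprS.
(* If [e] has [g] vertices in [U], at most [n - g] branches remain, and plain branching already
   gains the factor [q]. *)
have [big|small] := leqP g #|` e `&` U|.
  apply: (@le_trans _ _ ((n - g)%:R * (N * q ^+ r * a ^+ (g - j)))); last first.
    by rewrite -qn exprS le_eqVlt; apply/orP; left; apply/eqP; ring.
  apply: (@le_trans _ _ (\sum_(x <- e `\` U) #|` extensions F (x |` A) U|)%:R).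
    by rewrite ler_nat branch_plain.
  rewrite natr_sum.
  apply: (@sum_extensions_le _ _ A e (e `\` U) (fun B => #|` extensions F B U|%:R)) => //.
  - exact: fsubsetDl.
  - by lia.
  - by move=> x Ax; apply: (IH j _ _ D) => //; lia.
(* Now [spread] leaves room for one more edge in [U], and [D] grows by fewer than [g] vertices. *)
have {}jg : (j < g)%N by have := UDj e Ee eD; lia.
have gjS : (g - j = (g - j.+1).+1)%N by lia.
have DeU : (#|` D `|` (e `&` U)| <= g * j.+1)%N.
  by have := cardfsU D (e `&` U); rewrite mulnS; lia.
rewrite -(ler_pM2l (ltr0Sn K 1)).
apply: (@le_trans _ _ (n%:R * (N * q ^+ r * a ^+ (g - j) + N * q ^+ r * a ^+ (g - j.+1)))).
  rewrite -natrM.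
  apply: (@le_trans _ _ (\sum_(x <- e `\` U)
    (#|` extensions F (x |` A) U| + #|` extensions F (x |` A) (U `|` e)|))%:R).
    by rewrite ler_nat branch_half.
  rewrite natr_sum.
  apply: (@sum_extensions_le _ _ A e (e `\` U) (fun B =>
    (#|` extensions F B U| + #|` extensions F B (U `|` e)|)%:R)) => //.
  - exact: fsubsetDl.
  - by lia.
  - exact: addr_ge0.
  - move=> x Ax; rewrite natrD lerD //.
      by apply: (IH j _ _ D) => //; lia.
    apply: (IH j.+1 _ _ (D `|` (e `&` U))) => //; first by lia.
    by apply: spreadS => // f Ef; exact: EI.
rewrite gjS !exprS.
have M0 : 0 <= n%:R * N * q ^+ r * a ^+ (g - j.+1).
  by rewrite -!mulrA mulr_ge0 // mulrA.
rewrite /a in M0 *.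
have -> : 2 * (n%:R * N * (q * q ^+ r) * (6 / 5 * (6 / 5) ^+ (g - j.+1)))
  = n%:R * N * q ^+ r * (6 / 5) ^+ (g - j.+1) * (12 / 5 * q) :> K by field.
have -> : n%:R * (N * q ^+ r * (6 / 5 * (6 / 5) ^+ (g - j.+1))
    + N * q ^+ r * (6 / 5) ^+ (g - j.+1))
  = n%:R * N * q ^+ r * (6 / 5) ^+ (g - j.+1) * (11 / 5) :> K by field.
(* What remains is [11 / 5 <= 12 / 5 * q], which is [q_ge]. *)
by apply: ler_wpM2l => //; lra.
Qed.

End Bounds.

(** * Numerical estimates *)

Lemma cube_le_exp2 (g : nat) : (12 <= g -> 2 * g ^ 3 <= 2 ^ g)%N.
Proof.
elim: g => // g IH; rewrite leq_eqVlt => /predU1P[<-|]; first by [].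
rewrite ltnS => g12; have := IH g12; rewrite [(2 ^ g.+1)%N]expnS => h.
apply: (leq_trans _ (leq_mul (leqnn 2) h)).
rewrite !expnS !expn0; nia.
Qed.

Lemma bernoulli (K : realFieldType) (x : K) (k : nat) :
  0 <= x <= 1 -> 1 - k%:R * x <= (1 - x) ^+ k.
Proof.
move=> /andP[x0 x1]; elim: k => [|k IH]; first by rewrite mul0r subr0 expr0.
rewrite exprS; apply: (@le_trans _ _ ((1 - x) * (1 - k%:R * x))); last first.
  by rewrite ler_wpM2l // subr_ge0.
have : 0 <= k%:R * x * x by rewrite !mulr_ge0.
by rewrite -[k.+1]addn1 natrD; lra.
Qed.

Lemma expR1_ge (R : realType) : 12 / 5 <= expR (1 : R).
Proof.
have -> : expR (1 : R) = expR 4^-1 ^+ 4 by rewrite -expRM_natl divff.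
(* [(5 / 4) ^ 4 = 625 / 256] just exceeds [12 / 5]. *)
apply: (@le_trans _ _ ((1 + 4^-1) ^+ 4)); first by lra.
by rewrite lerXn2r ?nnegrE ?expR_ge0 ?expR_ge1Dx //; lra.
Qed.

(** With exponent [n] the product is at most [(6 / 5) ^ g / expR g], hence at most [2 ^ -g], which
    is below [2 / n]. Lowering the exponent by [g * g] costs a factor at most 2, by Bernoulli and
    [2 * g ^ 3 <= n]. *)
Lemma decay_log_le (R : realType) (n : nat) (g := trunc_log 2 n) :
  (4096 <= n)%N ->
  (1 - g%:R / n%:R) ^+ (n - g * g) * (6 / 5) ^+ g <= 4 / n%:R :> R.
Proof.
move=> n_ge.
have g12 : (12 <= g)%N by rewrite trunc_log_max.
have g_le : (2 ^ g <= n)%N by apply: trunc_logP; lia.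
have g_lt : (n < 2 ^ g.+1)%N by apply: trunc_log_ltn.
have g3 : (2 * g ^ 3 <= n)%N by apply: leq_trans g_le; exact: cube_le_exp2.
have nR : 0 < n%:R :> R by rewrite ltr0n; lia.
have ggn : (g * g <= n)%N by move: g3; rewrite !expnS expn0; nia.
set x : R := g%:R / n%:R.
have x01 : 0 <= x <= 1.
  by rewrite divr_ge0 //= ler_pdivrMr // mul1r ler_nat; nia.
have hB : 2^-1 <= (1 - x) ^+ (g * g).
  apply: le_trans (bernoulli (g * g) x01).
  have : (g * g)%:R * x <= 2^-1.
    rewrite /x mulrA ler_pdivrMr // -natrM.
    have : (2 * g ^ 3)%:R <= n%:R :> R by rewrite ler_nat.
    by rewrite natrM !expnS expn0 muln1 mulnA; lra.
  lra.
have hE : (1 - x) ^+ n * (12 / 5) ^+ g <= 1.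
  apply: (@le_trans _ _ (expR (- x) ^+ n * expR 1 ^+ g)).
    apply: ler_pM; rewrite ?exprn_ge0 //; try lra.
      by rewrite lerXn2r ?nnegrE ?expR_ge0 ?expR_ge1Dx //; lra.
    by rewrite lerXn2r ?nnegrE ?expR_ge0 ?expR1_ge //; lra.
  rewrite -!expRM_natr -expRD mulNr /x divfK ?gt_eqF // mul1r addrC subrr.
  by rewrite expR0.
set X := (1 - x) ^+ (n - g * g).
have X0 : 0 <= X by rewrite exprn_ge0 //; lra.
have hX : (1 - x) ^+ n = X * (1 - x) ^+ (g * g) by rewrite -exprD subnK.
have hX2 : X <= 2 * (1 - x) ^+ n.
  by rewrite hX; have := ler_wpM2l X0 hB; lra.
have a0 : 0 <= (6 / 5 : R) ^+ g by rewrite exprn_ge0 //; lra.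
rewrite ler_pdivlMr //.
have nle : n%:R <= 2 * 2 ^+ g :> R by rewrite -exprS -natrX ler_nat ltnW.
have h125 : (12 / 5 : R) ^+ g = (6 / 5) ^+ g * 2 ^+ g.
  by rewrite -exprMn; congr (_ ^+ _); field.
apply: (@le_trans _ _ (2 * (1 - x) ^+ n * (6 / 5) ^+ g * (2 * 2 ^+ g))).
  by apply: ler_pM => //; [exact: mulr_ge0|exact: ler_wpM2r].
have -> : 2 * (1 - x) ^+ n * (6 / 5) ^+ g * (2 * 2 ^+ g)
  = 4 * ((1 - x) ^+ n * (12 / 5) ^+ g) by rewrite h125; ring.
lra.
Qed.

Lemma critical_clique_card (R : realType) (T : choiceType) (n : nat)
    (E : {fset T} -> Prop) (F : {fset {fset T}}) :
  critical_clique n E -> (forall f, f \in F -> E f) -> (2 <= n)%N ->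
  (#|` F|%fset%:R : R) <= 4096 * n%:R ^+ n.-1.
Proof.
move=> crit FE n2.
have nR : 0 < n%:R :> R by rewrite ltr0n; lia.
have FS : (F `<=` extensions F fset0 fset0)%fset.
  by apply/fsubsetP => f fF; rewrite !inE /= fF fsetI0 !fsub0set.
apply: (@le_trans _ _ #|` extensions F fset0 fset0|%fset%:R).
  by rewrite ler_nat fsubset_leq_card.
have nn : n%:R ^+ n = n%:R * n%:R ^+ n.-1 :> R by rewrite -exprS prednK //; lia.
have P0 : 0 <= n%:R ^+ n.-1 :> R by rewrite exprn_ge0.
(* From [4096 = 2 ^ 12] on, [g] is at least 12, as [cube_le_exp2] requires; below, [n ^ n] is good
   enough. *)
have [n_lt|n_ge] := ltnP n 4096.
  apply: (@le_trans _ _ (n%:R ^+ n)).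
    by rewrite -natrX ler_nat (extensions_le_expn fset0 crit FE) // cardfs0.
  by rewrite nn ler_wpM2r // ler_nat ltnW.
set g := trunc_log 2 n.
have g12 : (12 <= g)%N by rewrite trunc_log_max.
have g_le : (2 ^ g <= n)%N by apply: trunc_logP; lia.
have g3 : (2 * g ^ 3 <= n)%N by apply: leq_trans g_le; exact: cube_le_exp2.
have gg : (g * g + (n - g * g) = n)%N by move: g3; rewrite !expnS expn0; nia.
have := @extensions_le_decay R T n g E F (n - g * g) 0 fset0 fset0 fset0 crit FE.
rewrite gg subn0 cardfs0 => h.
apply: le_trans (h _ _ _ _ _ _) _ => //; first by lia.
- by move: g3; rewrite !expnS expn0; nia.
- by lia.
rewrite -mulrA nn mulrAC.
apply: (@le_trans _ _ (n%:R * (4 / n%:R) * n%:R ^+ n.-1)).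
  by rewrite ler_wpM2r // ler_wpM2l // decay_log_le.
rewrite ler_wpM2r // mulrCA divff ?gt_eqF // mulr1.
by rewrite ler_nat.
Qed.

(** * From hypergraphs to critical cliques *)

Section Hypergraphs.
Local Open Scope classical_set_scope.
Local Open Scope card_scope.

Lemma two_coloring (H : hypergraph) (P : vertex H -> Prop) :
  chromatic_number H 3 ->
  exists2 e, edges H e & forall x y, e x -> e y -> (P x <-> P y).
Proof.
move=> [_ chi]; apply: contrapT => nex.
suff /chi : colorable H 2 by [].
exists (fun x => if `[< P x >] then ord0 else ord_max) => e He.
apply: contrapT => ne; apply: nex; exists e => // x y ex ey.
apply: contrapT => nP; apply: ne; exists x, y; split=> //.
by do 2 case: asboolP => //; tauto.
Qed.

(** Color by membership in [S]: some edge is monochromatic, and being too large to lie inside [S],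
    it avoids [S]. *)
Lemma admissible_critical (H : hypergraph) (n : nat) : (0 < n)%N -> admissible n H ->
  critical_clique n (fun e : {fset {classic vertex H}} => edges H [set` e]).
Proof.
move=> n0 [Hn Hc Hchi].
have fs e : edges H e -> [set` fset_set (e : set {classic vertex H})] = e.
  by move=> /Hn en; apply: fset_setK; exists n.
split.
- by move=> e He; apply/card_eq_fsetP; exact: Hn.
- move=> e f He Hf; have [x [ex fx]] := Hc _ _ He Hf.
  by apply/fset0Pn; exists x; rewrite inE; apply/andP.
move=> S Sn.
have [e He eP] := two_coloring (fun x => x \in S) Hchi.
have He' := He; rewrite -(fs _ He) in He'.
exists (fset_set (e : set {classic vertex H})) => //.
apply/fdisjointP => x xe; apply/negP => xS.
have ex : e x by rewrite -(fs _ He).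
have sub : (fset_set (e : set {classic vertex H}) `<=` S)%fset.
  apply/fsubsetP => y ye; have ey : e y by rewrite -(fs _ He).
  by apply/(eP x y ex ey).
have en : (e : set {classic vertex H}) #= `I_n := Hn _ He.
by have := fsubset_leq_card sub; rewrite (card_fset_set en); lia.
Qed.

Lemma admissible_card (R : realType) (H : hypergraph) (n : nat) :
  (2 <= n)%N -> admissible n H ->
  exists m, edges H #= `I_m /\ m%:R <= 4096 * n%:R ^+ n.-1 :> R.
Proof.
move=> n2 adm.
have crit := admissible_critical (ltnW n2) adm.
set E := (fun e : {fset {classic vertex H}} => _) in crit.
have EH : edges H #= [set e | E e].
  have -> : edges H = (fun e : {fset {classic vertex H}} => [set` e]) @` [set e | E e].
    apply/seteqP; split=> [e He|_ [e He <-] //].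
    have [Hn _ _] := adm.
    have eK : [set` fset_set (e : set {classic vertex H})] = e.
      by apply: fset_setK; exists n; apply: Hn.
    by exists (fset_set (e : set {classic vertex H})) => //=; rewrite /E eK.
  apply: inj_card_eq => e f _ _ ef.
  by rewrite -[e]set_fsetK -[f]set_fsetK ef.
have bound F : [set` F] `<=` [set e | E e] -> #|` F|%fset%:R <= 4096 * n%:R ^+ n.-1 :> R.
  by move=> FE; apply: (critical_clique_card R crit) => // f /FE.
have finE : finite_set [set e | E e].
  apply: contrapT => infE.
  (* An infinite edge set would contain a finite subfamily exceeding the uniform bound. *)
  have [F FE Fn] := infinite_set_fset (4096 * n ^ n.-1).+1 infE.
  have := bound F FE; rewrite -natrX -natrM ler_nat; lia.
exists #|` fset_set [set e | E e]|%fset; split; last by apply: bound; rewrite fset_setK.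
apply: card_eq_trans EH _.
by rewrite -{1}(fset_setK finE); apply/card_eq_fsetP.
Qed.

(** * Existence of the maximum *)

Definition complete_hypergraph (N n : nat) : hypergraph :=
  @Hypergraph 'I_N [set e | e #= `I_n].

Lemma complete_edgeP (N n : nat) (e : set 'I_N) :
  edges (complete_hypergraph N n) e ->
  exists2 X : {fset 'I_N}, #|` X|%fset = n & e = [set` X].
Proof.
move=> /= en; exists (fset_set e); first exact: card_fset_set.
by rewrite fset_setK //; exists n.
Qed.

Lemma complete_edge_in (N n : nat) (P : pred 'I_N) :
  (n <= #|P|)%N -> exists2 e, edges (complete_hypergraph N n) e & forall x, e x -> P x.
Proof.
move=> nP; exists [set` [fset x in take n (enum P)]%fset].
  apply/card_eq_fsetP; rewrite card_fseq undup_id ?take_uniq ?enum_uniq //.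
  by rewrite size_takel // -cardE.
by move=> x /=; rewrite inE => /mem_take; rewrite mem_enum.
Qed.

(** Among [2n - 1] points any two [n]-sets meet, and of two color classes one has at least [n]
    points. Three colors suffice: blocks of sizes [n - 1], [n - 1] and 1 contain no edge. *)
Lemma complete_admissible (n : nat) : (2 <= n)%N ->
  admissible n (complete_hypergraph (2 * n.-1).+1 n).
Proof.
move=> n2; split=> //.
- move=> e f /complete_edgeP[X Xn ->] /complete_edgeP[Y Yn ->].
  apply/set0P/negP => /eqP XY0.
  have XY : (X `&` Y)%fset = fset0.
    apply/fsetP => x; rewrite !inE; apply/negP => /andP[xX xY].
    by have : set0 x by rewrite -XY0.
  have : (#|` X `|` Y|%fset <= size (enum 'I_(2 * n.-1).+1))%N.
    by apply: uniq_leq_size (fset_uniq _) _ => x _; rewrite mem_enum.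
  have := cardfsUI X Y; rewrite size_enum_ord XY cardfs0; lia.
split.
  have n1 : (0 < n.-1)%N by lia.
  have lt3 (i : 'I_(2 * n.-1).+1) : (i %/ n.-1 < 3)%N.
    by rewrite ltn_divLR //; have := ltn_ord i; lia.
  exists (fun i => Ordinal (lt3 i)) => e /complete_edgeP[X Xn ->].
  apply: contrapT => mono.
  (* in a colour class, [i %% n.-1] determines [i] *)
  have : (size [seq i %% n.-1 | i : 'I_(2 * n.-1).+1 <- X] <= size (iota 0 n.-1))%N.
    apply: uniq_leq_size.
      rewrite map_inj_in_uniq ?fset_uniq // => i j iX jX ij.
      apply/val_inj; rewrite /= (divn_eq i n.-1) (divn_eq j n.-1) ij.
      suff -> : (i %/ n.-1 = j %/ n.-1)%N by [].
      apply: contrapT => nij; apply: mono; exists i, j; split=> //.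
      by move=> /(congr1 val).
    by move=> _ /mapP[i _ ->]; rewrite mem_iota /= add0n ltn_mod.
  by rewrite size_map size_iota [leqLHS]Xn; lia.
move=> j [col colP]; rewrite leqNgt; apply/negP => j3.
pose P : pred 'I_(2 * n.-1).+1 := fun x => col x == 0 :> nat.
have PC : (#|P| + #|[predC P]| = (2 * n.-1).+1)%N by rewrite cardC card_ord.
have [nP|nP] := leqP n #|P|.
  have [e He eP] := complete_edge_in nP.
  have [x [y [/eP/eqP x0 /eP/eqP y0]]] := colP e He.
  by apply; apply: val_inj; rewrite /= x0 y0.
have nPC : (n <= #|[predC P]|)%N by lia.
have [e He eP] := complete_edge_in nPC.
have [x [y [/eP/eqP x0 /eP/eqP y0]]] := colP e He.
apply; apply: val_inj => /=.
(* With at most two colors, a nonzero color can only be 1. *)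
by have := ltn_ord (col x); have := ltn_ord (col y); lia.
Qed.

Lemma max_edges_exists (n B : nat) :
  (exists H, admissible n H) ->
  (forall H, admissible n H -> exists2 m, edges H #= `I_m & (m <= B)%N) ->
  exists H m, [/\ admissible n H, edges H #= `I_m & max_edges n m].
Proof.
move=> [H0 adm0] bound.
pose P m := `[< exists H, admissible n H /\ edges H #= `I_m >].
have exP : exists m, P m.
  by have [m H0m _] := bound _ adm0; exists m; apply/asboolP; exists H0.
have PB m : P m -> (m <= B)%N.
  move=> /asboolP[H [adm Hm]]; have [m' Hm' m'B] := bound _ adm.
  suff -> : m = m' by [].
  by apply/card_eq_II; apply: card_eq_trans Hm'; rewrite card_eq_sym.
have [m /asboolP[H [adm Hm]] mmax] := ex_maxnP exP PB.
exists H, m; split=> //; split; first by exists H.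
move=> H' adm'; have [m' Hm' _] := bound _ adm'.
rewrite (card_le_eql Hm') card_le_II; apply: mmax.
by apply/asboolP; exists H'.
Qed.

End Hypergraphs.

Lemma expn_pred_le_powR_ln (R : realType) (n : nat) : (2 <= n)%N ->
  n%:R ^+ n.-1 <= 2 * n%:R `^ (n%:R - 2^-1) * ln n%:R :> R.
Proof.
move=> n2; have nR : 2 <= n%:R :> R by rewrite ler_nat.
have nR0 : 0 < n%:R :> R by lra.
have ln12 : 2^-1 <= ln n%:R :> R.
  apply: (@le_trans _ _ (ln (2 : R))); last by rewrite ler_ln ?posrE //; lra.
  (* [ln (1 / 2) <= - 1 / 2] yields [ln 2 >= 1 / 2]. *)
  have := @le_ln1Dx R (- 2^-1); have -> : 1 - 2^-1 = 2^-1 :> R by field.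
  rewrite lnV ?posrE //; lra.
apply: (@le_trans _ _ (n%:R `^ (n%:R - 2^-1))); last first.
  by have := powR_gt0 (n%:R - 2^-1) nR0; nra.
rewrite -powR_mulrn; last exact: ltW nR0.
rewrite ler_powR //; first by lra.
have -> : n = n.-1.+1 by lia.
by rewrite /= -natr1; lra.
Qed.

Theorem theorem2 (R : realType) :
  exists c : R, 0 < c /\
    forall n : nat, (2 <= n)%N ->
      exists m : nat, max_edges n m /\
        m%:R <= c * n%:R `^ (n%:R - 2^-1) * ln n%:R.
Proof.
(* 4096 comes from the edge bound, 2 from [ln n >= 1 / 2]. *)
exists (2 * 4096); split=> [|n n2]; first by rewrite mulr_gt0 ?ltr0n.
have bound H : admissible n H ->
    exists2 m, (edges H #= `I_m)%card & (m <= 4096 * n ^ n.-1)%N.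
  move=> adm; have [m [Hm mR]] := admissible_card R n2 adm; exists m => //.
  by move: mR; rewrite -natrX -natrM ler_nat.
have [|H [m [adm Hm mmax]]] := max_edges_exists _ bound.
  by exists (complete_hypergraph (2 * n.-1).+1 n); exact: complete_admissible.
exists m; split=> //.
have [m' Hm' m'B] := bound _ adm.
have -> : m = m'.
  by apply/card_eq_II; apply: card_eq_trans Hm'; rewrite card_eq_sym.
apply: (@le_trans _ _ (4096 * n%:R ^+ n.-1)).
  by rewrite -natrX -natrM ler_nat.
by have := expn_pred_le_powR_ln R n2; lra.
Qed.
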